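(* As $n\to\infty$ through odd integers, $\beta(F_n)=(2+o(1))\,n/\log_2 n$. As $n\to\infty$ through even integers, $(2+o(1))\,n/\log_2 n\le \beta(F_n)\le (4+o(1))\,n/\log_2 n$.
   Context: For $u\in\{0,1\}^n$, $\overline{u}=u+(1,\dots,1)\pmod 2$. The folded hypercube $F_n$ has vertex set $\{\{u,\overline{u}\}:u\in\{0,1\}^n\}$, with $\{u,\overline u\}$ adjacent to $\{v,\overline v\}$ iff $u$ and $v$, or $u$ and $\overline v$, differ in exactly one coordinate. For a graph $G$, a set $S\subseteq V(G)$ is resolving if for all distinct $u,v$ some $y\in S$ has $d_G(u,y)\neq d_G(v,y)$, and $\beta(G)$ is the minimum size of a resolving set. *)

(* Defs.v *)
From HB Require Import structures.
From mathcomp Require Import all_boot all_order all_algebra.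
From mathcomp Require Import reals exp.

Set Implicit Arguments.
Unset Strict Implicit.
Unset Printing Implicit Defensive.

Import Order.TTheory GRing.Theory Num.Theory.

Definition walk_of_length (T : finType) (e : rel T) (k : nat) (x y : T) : bool :=
  [exists p : k.-tuple T, path e x p && (last x p == y)].

(* When x and y lie in one connected component a shortest walk has fewer than *)
(* #|T| edges; otherwise the value is #|T|, which plays the role of infinity. *)
Definition dist (T : finType) (e : rel T) (x y : T) : nat :=
  find (fun k => walk_of_length e k x y) (iota 0 #|T|).

Definition resolving (T : finType) (e : rel T) (S : {set T}) : bool :=
  [forall u, forall v,
    (u != v) ==> [exists y in S, dist e u y != dist e v y]].

(* The default value [set: T] of the arg min is itself resolving, since       *)
(* dist e u y = 0 only for u = y.                                             *)
Definition metric_dim (T : finType) (e : rel T) : nat :=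
  #|[arg min_(S < [set: T] | resolving e S) #|S|]|.

Definition cube (n : nat) : finType := {ffun 'I_n -> bool}.

Definition antipode (n : nat) (u : cube n) : cube n :=
  [ffun i => u i (+) true].

Definition hamming (n : nat) (u v : cube n) : nat := #|[set i | u i != v i]|.

Definition folded_vertex (n : nat) : finType :=
  {A : {set cube n} | [exists u : cube n, A == [set u; antipode u]]}.

(* For n = 1 the single vertex is adjacent to itself; loops do not affect dist. *)
Definition folded_adj (n : nat) : rel (folded_vertex n) := fun A B =>
  [exists u : cube n, exists v : cube n,
    [&& val A == [set u; antipode u], val B == [set v; antipode v]
      & (hamming u v == 1) || (hamming u (antipode v) == 1)]].

Definition beta_folded (n : nat) : nat := metric_dim (@folded_adj n).

Definition log2 (R : realType) (x : R) : R := (ln x / ln 2)%R.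

(* Main.v *)
Require Import Defs.
From mathcomp Require Import all_boot all_order all_algebra.
From mathcomp Require Import zify ring lra.
From mathcomp Require Import all_classical all_reals all_analysis.
Import Order.TTheory GRing.Theory Num.Theory.
Import numFieldNormedType.Exports.

Set Implicit Arguments.
Unset Strict Implicit.
Unset Printing Implicit Defensive.

(* The distance of {u, ~u} and {v, ~v} in F_n is min(h, n - h) for the Hamming *)
(* distance h of u and v.                                                      *)
(*                                                                             *)
(* Lower bound. Let y_1, ..., y_k resolve F_n, let s ^ 2 >= n, and put         *)
(* a_j(u) = |n - 2 h(u, y_j)|. The second moment of n - 2 h over the cube is   *)
(* n, so each a_j has mean at most s, and X = \sum_j floor(a_j / s) has mean   *)
(* at most k; by convexity 2 ^ - X has mean at least 2 ^ - k. On the other     *)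
(* hand u |-> (a_j(u))_j is at most two-to-one, so the sum of 2 ^ - X over the *)
(* cube is at most 2 (\sum_a 2 ^ - floor(a / s)) ^ k <= 2 (2 s) ^ k. Hence     *)
(* 2 ^ n <= 2 (4 s) ^ k with s of order sqrt n.                                *)
(*                                                                             *)
(* Upper bound. A 0/1 matrix with m rows and n columns that determines every x *)
(* in {0,1}^n from its m row sums gives m + 1 vertices resolving the cube Q_n. *)
(* Doubling (m, n) to (2 m + 1, 2 n + m), starting with (1, 1), yields         *)
(* matrices of size (2 ^ (k+1) - 1, k 2 ^ k + 1); block diagonal copies of one *)
(* of them cover all n with m = (2 + o(1)) n / log2 n. A resolving set of Q_n  *)
(* resolves F_n when n is odd, and twice as many vertices suffice for every n. *)

(** * Graph distance and metric dimension *)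

Section DistanceCharacterization.
Variables (T : finType) (e : rel T).

Lemma walk_of_length0 x y : walk_of_length e 0 x y = (x == y).
Proof.
apply/existsP/eqP => [[p]|->]; first by rewrite (tuple0 p) /= => /eqP.
by exists [tuple]; rewrite /= eqxx.
Qed.

Lemma walk_of_lengthS k x y :
  walk_of_length e k.+1 x y = [exists z, e x z && walk_of_length e k z y].
Proof.
apply/existsP/existsP => [[p]|[z /andP[exz /existsP[p /andP[ep ly]]]]].
  case: (tupleP p) => z q /= /andP[/andP[exz eq] ly].
  by exists z; rewrite exz; apply/existsP; exists q; rewrite eq.
by exists [tuple of z :: p]; rewrite /= exz ep.
Qed.

Variable D : T -> T -> nat.
Hypothesis D_eq0 : forall x y, (D x y == 0) = (x == y).
Hypothesis D_lipschitz : forall x y z, e x y -> D x z <= (D y z).+1.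
Hypothesis D_descent :
  forall x z, 0 < D x z -> exists2 y, e x y & D x z = (D y z).+1.

Lemma walk_of_length_ge k x z : walk_of_length e k x z -> D x z <= k.
Proof.
elim: k x => [|k IHk] x; first by rewrite walk_of_length0 -D_eq0 leqn0.
rewrite walk_of_lengthS => /existsP[y /andP[exy /IHk Dy]].
exact: leq_trans (D_lipschitz _ exy) _.
Qed.

Lemma walk_of_length_descent x z : walk_of_length e (D x z) x z.
Proof.
move Dx: (D x z) => k; elim: k x Dx => [|k IHk] x Dx.
  by rewrite walk_of_length0 -D_eq0 Dx.
have [|y exy Dy] := @D_descent x z; first by rewrite Dx.
rewrite walk_of_lengthS; apply/existsP; exists y; rewrite exy IHk //.
by move: Dy; rewrite Dx => -[].
Qed.

Lemma descent_intermediate x z j : j <= D x z -> exists y, D y z = j.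
Proof.
move Dx: (D x z) => k; elim: k x Dx => [|k IHk] x Dx.
  by rewrite leqn0 => /eqP->; exists x.
rewrite leq_eqVlt => /orP[/eqP->|ltjk]; first by exists x.
have [|y _ Dy] := @D_descent x z; first by rewrite Dx.
by apply: (IHk y) => //; move: Dy; rewrite Dx => -[].
Qed.

Lemma descent_lt_card x z : D x z < #|T|.
Proof.
have : {subset iota 0 (D x z).+1 <= codom (D^~ z)}.
  move=> j; rewrite mem_iota add0n ltnS => /descent_intermediate[y <-].
  exact: codom_f.
by move/(uniq_leq_size (iota_uniq _ _)); rewrite size_iota size_codom.
Qed.

Lemma dist_eq x z : dist e x z = D x z.
Proof.
rewrite /dist; set P := fun k => _; set s := iota _ _.
have nth_s k : k < #|T| -> nth 0 s k = k by move=> ltkT; rewrite nth_iota.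
have DltT := descent_lt_card x z.
have [ltD|gtD|//] := ltngtP (find P s) (D x z).
  have find_ltT := ltn_trans ltD DltT.
  have hasP : has P s by rewrite has_find size_iota.
  have := nth_find 0 hasP; rewrite nth_s // => /walk_of_length_ge.
  by rewrite leqNgt ltD.
by have := before_find 0 gtD; rewrite nth_s // /P walk_of_length_descent.
Qed.

End DistanceCharacterization.

Definition separating (V W J : Type) (d : V -> W -> nat) (y : J -> W) : Prop :=
  forall u v, (forall j, d u (y j) = d v (y j)) -> u = v.

Section MetricDimension.
Variables (T : finType) (e : rel T).

Lemma dist_eq0 x y : (dist e x y == 0) = (x == y).
Proof.
rewrite /dist; have : 0 < #|T| by apply/card_gt0P; exists x.
by case: #|T| => // m _ /=; rewrite walk_of_length0; case: (x == y).
Qed.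

Lemma resolvingP (S : {set T}) :
  reflect (forall u v, {in S, forall y, dist e u y = dist e v y} -> u = v)
          (resolving e S).
Proof.
apply: (iffP forallP) => [resS u v uvS|sepS u].
  have [//|neq_uv] := eqVneq u v; have /forallP/(_ v) := resS u.
  by rewrite neq_uv => /exists_inP[y /uvS->]; rewrite eqxx.
apply/forallP => v; apply/implyP; apply: contraR => /existsPn noS.
by apply/eqP/sepS => y yS; apply/eqP; have := noS y; rewrite yS negbK.
Qed.

Lemma resolving_setT : resolving e [set: T].
Proof.
apply/resolvingP => u v /(_ v (finset.in_setT v))/eqP.
by rewrite (eqP (_ : dist e v v == 0)) ?dist_eq0 // => /eqP.
Qed.

Lemma metric_dim_le (J : finType) (y : J -> T) :
  separating (dist e) y -> metric_dim e <= #|J|.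
Proof.
move=> sep_y; apply: leq_trans (leq_imset_card y J); rewrite /metric_dim.
case: arg_minnP => [|S _ minS]; first exact: resolving_setT.
apply/minS/resolvingP => u v uv_y; apply: sep_y => j.
by apply: uv_y; apply: imset_f.
Qed.

Lemma metric_dim_separating :
  exists y : 'I_(metric_dim e) -> T, separating (dist e) y.
Proof.
rewrite /metric_dim; case: arg_minnP => [|S /resolvingP resS _].
  exact: resolving_setT.
exists enum_val => u v uvS; apply: resS => y yS.
by have := uvS (enum_rank_in yS y); rewrite enum_rankK_in.
Qed.

End MetricDimension.

(** * Distances in the cube and the folded cube *)

Section Cube.
Variable n : nat.
Implicit Types u v w : cube n.

Lemma card_cube : #|cube n| = 2 ^ n.
Proof. by rewrite card_ffun card_bool card_ord. Qed.

Lemma antipodeK : involutive (@antipode n).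
Proof. by move=> u; apply/ffunP => i; rewrite !ffunE; case: (u i). Qed.

Lemma hammingE u v : hamming u v = \sum_i (u i != v i).
Proof.
rewrite /hamming cardsE -sum1_card big_mkcond /=; apply: eq_bigr => i _.
by rewrite unfold_in; case: (u i != v i).
Qed.

Lemma hammingC u v : hamming u v = hamming v u.
Proof. by rewrite !hammingE; apply: eq_bigr => i _; rewrite eq_sym. Qed.

Lemma hamming_le u v : hamming u v <= n.
Proof. by rewrite -[X in _ <= X]card_ord max_card. Qed.

Lemma hamming_eq0 u v : (hamming u v == 0) = (u == v).
Proof.
rewrite hammingE sum_nat_eq0; apply/forallP/eqP => [uv|-> i].
  by apply/ffunP => i; have := uv i; rewrite eqb0 negbK => /eqP.
by rewrite eqxx.
Qed.

Lemma hamming_triangle v u w : hamming u w <= hamming u v + hamming v w.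
Proof.
rewrite !hammingE -big_split /=; apply: leq_sum => i _.
by case: (u i) (v i) (w i) => [] [] [].
Qed.

Lemma odd_hamming w u v :
  odd (hamming u v) = odd (hamming u w) (+) odd (hamming v w).
Proof.
rewrite !hammingE -oddD -big_split /= !(big_morph odd oddD (erefl _)) /=.
by apply: eq_bigr => i _; case: (u i) (v i) (w i) => [] [] [].
Qed.

Lemma hamming_antipode u v : hamming u (antipode v) = n - hamming u v.
Proof.
apply/eqP; rewrite -(eqn_add2r (hamming u v)) subnK ?hamming_le // !hammingE.
rewrite -big_split /= -[X in _ == X](card_ord n) -sum1_card; apply/eqP.
by apply: eq_bigr => i _; rewrite ffunE; case: (u i) (v i) => [] [].
Qed.

Definition flip (i : 'I_n) u : cube n := [ffun j => u j (+) (j == i)].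

Lemma flipK i : involutive (flip i).
Proof. by move=> u; apply/ffunP => j; rewrite !ffunE -addbA addbb addbF. Qed.

Lemma hamming_flip i u v :
  hamming u (flip i v) + (u i != v i) = hamming u v + (u i == v i).
Proof.
rewrite !hammingE (bigD1 i) //= [in RHS](bigD1 i) //= ffunE eqxx.
rewrite (eq_bigr (fun j => nat_of_bool (u j != v j))) => [|j /negbTE neq_ji].
  by case: (u i) (v i) => [] []; rewrite /= ?addn0 ?add0n addnC.
by rewrite ffunE neq_ji addbF.
Qed.

Lemma hamming_flip_self i u : hamming u (flip i u) = 1.
Proof.
have := hamming_flip i u u; rewrite eqxx addn0 => ->.
by have /eqP-> : hamming u u == 0 by rewrite hamming_eq0.
Qed.

Definition fold_dist u v := minn (hamming u v) (n - hamming u v).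

Lemma fold_distC u v : fold_dist u v = fold_dist v u.
Proof. by rewrite /fold_dist hammingC. Qed.

Lemma fold_dist_antipoder u v : fold_dist u (antipode v) = fold_dist u v.
Proof. by rewrite /fold_dist hamming_antipode subKn ?hamming_le // minnC. Qed.

Lemma fold_dist_antipodel u v : fold_dist (antipode u) v = fold_dist u v.
Proof. by rewrite fold_distC fold_dist_antipoder fold_distC. Qed.

Lemma fold_dist_eq0 u v : (fold_dist u v == 0) = (u == v) || (u == antipode v).
Proof.
rewrite -!hamming_eq0 hamming_antipode /fold_dist.
by have := hamming_le u v; lia.
Qed.

Lemma fold_dist_lipschitz u v w :
  hamming u v = 1 -> fold_dist u w <= (fold_dist v w).+1.
Proof.
have := hamming_triangle v u w; have := hamming_triangle u v w.
rewrite (hammingC v u) /fold_dist; move: (hamming u w) (hamming v w) => a b.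
lia.
Qed.

Lemma fold_dist_descent u v : 0 < fold_dist u v ->
  exists2 u', hamming u u' = 1 & fold_dist u v = (fold_dist u' v).+1.
Proof.
wlog closer : v / hamming u v <= n - hamming u v.
  move=> descent; have [|farther] := leqP (hamming u v) (n - hamming u v).
    exact: descent.
  rewrite -(fold_dist_antipoder u v) => /descent[|u' uu' ->].
    by rewrite hamming_antipode; lia.
  by exists u' => //; rewrite fold_dist_antipoder.
move=> d_gt0; have /existsP[i neq_i] : [exists i, u i != v i].
  apply: contraTT d_gt0 => /existsPn eq_uv; rewrite -eqn0Ngt fold_dist_eq0.
  by apply/orP; left; apply/eqP/ffunP => i; apply/eqP; rewrite -[_ == _]negbK.
exists (flip i u); first exact: hamming_flip_self.
have := hamming_flip i v u; rewrite eq_sym (negbTE neq_i) addn0 addn1.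
by move: closer; rewrite /fold_dist (hammingC u) (hammingC (flip i u)); lia.
Qed.

Lemma folded_class_proof u :
  [exists v : cube n, [set u; antipode u] == [set v; antipode v] ].
Proof. by apply/existsP; exists u. Qed.

Definition folded_class u : folded_vertex n :=
  exist (fun A : {set cube n} => [exists v, A == [set v; antipode v]]) _
        (folded_class_proof u).

Lemma folded_class_antipode u : folded_class (antipode u) = folded_class u.
Proof. by apply: val_inj; rewrite /= antipodeK finset.setUC. Qed.

Lemma folded_class_eq u v :
  (folded_class u == folded_class v) = (u == v) || (u == antipode v).
Proof.
apply/eqP/orP => [[/setP/(_ u)]|[]/eqP-> //]; last exact: folded_class_antipode.
by rewrite !inE eqxx => /esym/orP.
Qed.

Lemma folded_class_surj (A : folded_vertex n) : exists u, A == folded_class u.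
Proof. by have /existsP[u] := valP A; exists u. Qed.

Definition folded_repr (A : folded_vertex n) : cube n :=
  xchoose (folded_class_surj A).

Lemma folded_reprK : cancel folded_repr folded_class.
Proof. by move=> A; apply/esym/eqP/(xchooseP (folded_class_surj A)). Qed.

Lemma fold_dist_repr u v :
  fold_dist (folded_repr (folded_class u)) (folded_repr (folded_class v)) =
  fold_dist u v.
Proof.
have reprE w : folded_repr (folded_class w) = w \/
    folded_repr (folded_class w) = antipode w.
  by have /eqP := folded_reprK (folded_class w);
     rewrite folded_class_eq => /orP[]/eqP; [left | right].
by have [-> | ->] := reprE u; have [-> | ->] := reprE v;
   rewrite ?fold_dist_antipodel ?fold_dist_antipoder.
Qed.

Lemma folded_adjP (A B : folded_vertex n) :
  reflect
    (exists u v, [/\ A = folded_class u, B = folded_class v & hamming u v = 1])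
    (folded_adj A B).
Proof.
apply: (iffP existsP) => [[u /existsP[v /and3P[/eqP Au /eqP Bv adj_uv]]]|].
  have -> : A = folded_class u by apply: val_inj.
  have -> : B = folded_class v by apply: val_inj.
  case/orP: adj_uv => /eqP; first by exists u, v.
  by exists u, (antipode v); rewrite folded_class_antipode.
move=> [u [v [-> -> uv]]]; exists u; apply/existsP; exists v.
by rewrite uv !eqxx.
Qed.

Lemma dist_folded_class u v :
  dist (@folded_adj n) (folded_class u) (folded_class v) = fold_dist u v.
Proof.
rewrite (dist_eq (D := fun A B => fold_dist (folded_repr A) (folded_repr B))).
- exact: fold_dist_repr.
- by move=> A B; rewrite fold_dist_eq0 -folded_class_eq !folded_reprK.
- move=> A B C /folded_adjP[x [y [-> -> xy]]].
  by rewrite -(folded_reprK C) !fold_dist_repr fold_dist_lipschitz.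
move=> A B; rewrite -(folded_reprK A) -(folded_reprK B) fold_dist_repr.
move=> /fold_dist_descent[x Ax ->]; exists (folded_class x).
  by apply/folded_adjP; exists (folded_repr A), x.
by rewrite fold_dist_repr.
Qed.

End Cube.

Definition fold_separating n (J : Type) (y : J -> cube n) : Prop :=
  forall u v, (forall j, fold_dist u (y j) = fold_dist v (y j)) ->
  folded_class u = folded_class v.

Lemma beta_folded_le n (J : finType) (y : J -> cube n) :
  fold_separating y -> beta_folded n <= #|J|.
Proof.
move=> sep_y; apply: (metric_dim_le (y := @folded_class n \o y)) => A B.
rewrite -(folded_reprK A) -(folded_reprK B) => AB; apply: sep_y => j.
by have := AB j; rewrite /= !dist_folded_class.
Qed.

Lemma beta_folded_separating n :
  exists y : 'I_(beta_folded n) -> cube n, fold_separating y.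
Proof.
have [y sep_y] := metric_dim_separating (@folded_adj n).
exists (@folded_repr n \o y) => u v uv; apply: sep_y => j.
by rewrite -(folded_reprK (y j)) !dist_folded_class; apply: uv.
Qed.

(** * From the cube to the folded cube *)

(* Since v and its antipode are identified, it is enough to compare u with *)
(* whichever of the two is related to u by P.                              *)
Lemma separating_fold n (P : rel (cube n)) (J J' : Type)
    (y : J -> cube n) (z : J' -> cube n) :
    (forall u v, P u v || P u (antipode v)) ->
    (forall u v, P u v ->
       (forall j, fold_dist u (z j) = fold_dist v (z j)) ->
     forall j, hamming u (y j) = hamming v (y j)) ->
  separating (@hamming n) y -> fold_separating z.
Proof.
move=> total_P P_sep sep_y u v uv.
case/orP: (total_P u v) => [Puv|Puv'].
  by rewrite (sep_y u v) //; apply: P_sep.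
rewrite -(folded_class_antipode v) (sep_y u (antipode v)) //.
apply: P_sep => // j.
by rewrite fold_dist_antipodel.
Qed.

(* For odd n the two candidates d and n - d for a Hamming distance have *)
(* different parities.                                                  *)
Lemma fold_dist_inj_even n (u v w : cube n) :
    odd n -> ~~ odd (hamming u v) -> fold_dist u w = fold_dist v w ->
  hamming u w = hamming v w.
Proof.
rewrite (odd_hamming w) /fold_dist.
by have := hamming_le u w; have := hamming_le v w; lia.
Qed.

Lemma separating_fold_odd n (J : Type) (y : J -> cube n) :
  odd n -> separating (@hamming n) y -> fold_separating y.
Proof.
move=> odd_n; apply: (@separating_fold _ (fun u v => ~~ odd (hamming u v))).
  move=> u v; rewrite hamming_antipode oddB ?hamming_le // odd_n /=.
  by case: odd.
by move=> u v even_uv uv j; apply: fold_dist_inj_even.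
Qed.

(* Flipping a coordinate of w on which u and v agree moves both distances d   *)
(* in the same direction, so the change of min(d, n - d) tells on which side  *)
(* of n / 2 they lie.                                                         *)
Lemma fold_dist_inj_flip n (i : 'I_n) (u v w : cube n) :
    u i = v i -> fold_dist u w = fold_dist v w ->
    fold_dist u (flip i w) = fold_dist v (flip i w) ->
  hamming u w = hamming v w.
Proof.
move=> uv_i; have := hamming_flip i u w; have := hamming_flip i v w.
rewrite /fold_dist uv_i; case: (v i == w i) => /=;
have := hamming_le u w; have := hamming_le v w;
have := hamming_le u (flip i w); have := hamming_le v (flip i w); lia.
Qed.

Definition flip_if n (i : 'I_n) (b : bool) (w : cube n) : cube n :=
  if b then flip i w else w.

Lemma separating_fold_flip n (i : 'I_n) (J : Type) (y : J -> cube n) :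
    separating (@hamming n) y ->
  fold_separating (fun jb : J * bool => flip_if i jb.2 (y jb.1)).
Proof.
apply: (@separating_fold _ (fun u v => u i == v i)).
  by move=> u v; rewrite ffunE; case: (u i) (v i) => [] [].
move=> u v /eqP uv_i uv j.
exact: fold_dist_inj_flip uv_i (uv (j, false)) (uv (j, true)).
Qed.

(** * Detecting matrices *)

Definition row_sum (I J : finType) (A : J -> I -> bool) (x : I -> bool) (j : J) :
    nat :=
  \sum_i (A j i && x i).

Definition detecting (I J : finType) (A : J -> I -> bool) : Prop :=
  forall x x', row_sum A x =1 row_sum A x' -> x =1 x'.

Definition detectable (m n : nat) : Prop :=
  exists (I J : finType) (A : J -> I -> bool),
    [/\ detecting A, #|J| = m & n <= #|I|].

Lemma detectable_leq m n n' : n' <= n -> detectable m n -> detectable m n'.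
Proof.
move=> le_n [I [J [A [detA card_J le_I]]]]; exists I, J, A; split=> //.
exact: leq_trans le_I.
Qed.

Lemma detecting_cols (I I' J : finType) (f : I' -> I) (A : J -> I -> bool) :
  injective f -> detecting A -> detecting (fun j => A j \o f).
Proof.
move=> f_inj detA x x' xx'.
pose ext (z : I' -> bool) i := [exists i', (f i' == i) && z i'].
have extf z i' : ext z (f i') = z i'.
  apply/existsP/idP => [[k /andP[/eqP/f_inj->]]//|zi].
  by exists i'; rewrite eqxx.
have row_sum_ext z : row_sum A (ext z) =1 row_sum (fun j => A j \o f) z.
  move=> j; rewrite /row_sum (bigID (mem [set f i' | i' in predT])) /=.
  rewrite [X in _ + X]big1 ?addn0 => [|i Nfi].
    rewrite big_imset => [|? ? _ _ /f_inj//].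
    by apply: eq_bigr => i' _; rewrite extf.
  suff -> : ext z i = false by rewrite andbF.
  by apply: contraNF Nfi => /existsP[i' /andP[/eqP<- _]]; apply: imset_f.
have eq_ext : ext x =1 ext x' by apply: detA => j; rewrite !row_sum_ext.
by move=> i; rewrite -extf eq_ext extf.
Qed.

Lemma detectable_ord m n : detectable m n ->
  exists (J : finType) (A : J -> 'I_n -> bool), detecting A /\ #|J| = m.
Proof.
move=> [I [J [A [detA card_J le_I]]]].
exists J, (fun j => A j \o (enum_val \o widen_ord le_I)); split=> //.
by apply: detecting_cols detA => i i' /enum_val_inj/(congr1 val)/= /val_inj.
Qed.

Section BlockDiagonal.
Variables (I1 I2 J1 J2 : finType).
Variables (A1 : J1 -> I1 -> bool) (A2 : J2 -> I2 -> bool).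

Definition block_diag (j : J1 + J2) (i : I1 + I2) : bool :=
  match j, i with
  | inl j, inl i => A1 j i
  | inr j, inr i => A2 j i
  | _, _ => false
  end.

Lemma row_sum_block_diag x j : row_sum block_diag x j =
  match j with
  | inl j => row_sum A1 (x \o inl) j
  | inr j => row_sum A2 (x \o inr) j
  end.
Proof.
by case: j => j; rewrite /row_sum big_sumType /= sum_nat_const muln0 ?addn0.
Qed.

Lemma detecting_block_diag :
  detecting A1 -> detecting A2 -> detecting block_diag.
Proof.
move=> det1 det2 x x' xx'.
have x_inl : x \o inl =1 x' \o inl.
  by apply: det1 => j; have := xx' (inl j); rewrite !row_sum_block_diag.
have x_inr : x \o inr =1 x' \o inr.
  by apply: det2 => j; have := xx' (inr j); rewrite !row_sum_block_diag.
by case=> i; [apply: x_inl | apply: x_inr].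
Qed.

End BlockDiagonal.

Lemma detectable_add m1 n1 m2 n2 :
  detectable m1 n1 -> detectable m2 n2 -> detectable (m1 + m2) (n1 + n2).
Proof.
move=> [I1 [J1 [A1 [det1 card_J1 le_I1]]]] [I2 [J2 [A2 [det2 card_J2 le_I2]]]].
exists (I1 + I2)%type, (J1 + J2)%type, (block_diag A1 A2).
rewrite !card_sum card_J1 card_J2 leq_add //; split=> //.
exact: detecting_block_diag.
Qed.

Lemma detectable_mul q m n : detectable m n -> detectable (q * m) (q * n).
Proof.
move=> det_mn; elim: q => [|q IHq].
  exists void, void, (fun _ _ => false); rewrite !mul0n !card_void.
  by split=> // x x' _ [].
by rewrite !mulSn; apply: detectable_add.
Qed.

Section Doubling.
Variables (I J : finType) (A : J -> I -> bool).

Definition doubled (j : J + J + unit) (i : I + I + J) : bool :=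
  match j, i with
  | inl (inl j), inl (inl i) | inl (inl j), inl (inr i) => A j i
  | inl (inl j), inr k => k == j
  | inl (inr j), inl (inl i) => A j i
  | inl (inr j), inl (inr i) => ~~ A j i
  | inr _, inl (inr i) => true
  | _, _ => false
  end.

Implicit Type x : I + I + J -> bool.

Definition left_part x : I -> bool := fun i => x (inl (inl i)).
Definition right_part x : I -> bool := fun i => x (inl (inr i)).

Lemma row_sum_doubled_same x j :
  row_sum doubled x (inl (inl j)) =
  row_sum A (left_part x) j + row_sum A (right_part x) j + x (inr j).
Proof.
rewrite /row_sum !big_sumType /=; congr (_ + _).
by rewrite (bigD1 j) //= eqxx big1 ?addn0 // => k /negbTE->.
Qed.

Lemma row_sum_doubled_compl x j :
  row_sum doubled x (inl (inr j)) + row_sum A (right_part x) j =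
  row_sum A (left_part x) j + row_sum doubled x (inr tt).
Proof.
rewrite /row_sum !big_sumType /= !sum_nat_const !muln0 !addn0 add0n.
rewrite -addnA -big_split /=; congr (_ + _).
by apply: eq_bigr => i _; rewrite /right_part; case: (A j i) (x _) => [] [].
Qed.

(* Adding the row sums of (A_j, A_j, e_j) and (A_j, ~ A_j, 0) and subtracting *)
(* that of (0, 1, 0) leaves twice a row sum of A plus the bit x (inr j),      *)
(* which the parity therefore reveals.                                        *)
Lemma row_sum_doubled_inj x x' j :
    row_sum doubled x =1 row_sum doubled x' ->
  [/\ row_sum A (left_part x) j = row_sum A (left_part x') j,
      row_sum A (right_part x) j = row_sum A (right_part x') j
    & x (inr j) = x' (inr j)].
Proof.
move=> xx'.
have := row_sum_doubled_same x j; have := row_sum_doubled_same x' j.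
have := row_sum_doubled_compl x j; have := row_sum_doubled_compl x' j.
by rewrite !xx'; case: (x (inr j)) (x' (inr j)) => [] []; split; lia.
Qed.

Lemma detecting_doubled : detecting A -> detecting doubled.
Proof.
move=> detA x x' xx'; case=> [[]|] i.
- apply: (detA (left_part x) (left_part x')) => j.
  by case: (row_sum_doubled_inj j xx').
- apply: (detA (right_part x) (right_part x')) => j.
  by case: (row_sum_doubled_inj j xx').
- by case: (row_sum_doubled_inj i xx').
Qed.

End Doubling.

Lemma detectable_double m n :
  detectable m n -> detectable (m + m + 1) (n + n + m).
Proof.
move=> [I [J [A [detA card_J le_I]]]].
exists (I + I + J)%type, (J + J + unit)%type, (doubled A).
rewrite !card_sum card_unit card_J leq_add2r leq_add //.
by split=> //; apply: detecting_doubled.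
Qed.

Lemma detectable_expn k : detectable (2 ^ k.+1).-1 (k * 2 ^ k).+1.
Proof.
elim: k => [|k /detectable_double].
  exists unit, unit, (fun _ _ => true); rewrite card_unit; split=> //.
  move=> x x' /(_ tt); rewrite /row_sum !(big_pred1 tt) => [|[]//|[]//].
  by move=> /= xx' []; case: (x tt) (x' tt) xx' => [] [].
have -> : (2 ^ k.+1).-1 + (2 ^ k.+1).-1 + 1 = (2 ^ k.+2).-1.
  by rewrite !expnS; have := expn_gt0 2 k; lia.
suff -> : (k * 2 ^ k).+1 + (k * 2 ^ k).+1 + (2 ^ k.+1).-1 =
          (k.+1 * 2 ^ k.+1).+1 by [].
by rewrite !expnS; have := expn_gt0 2 k; lia.
Qed.

Lemma detectable_exists k n : 0 < k ->
  exists2 m, detectable m n & m <= (n %/ (k * 2 ^ k)).+1 * 2 ^ k.+1.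
Proof.
move=> k_gt0; set q := (n %/ _).+1; exists (q * (2 ^ k.+1).-1).
  apply: detectable_leq (detectable_mul q (detectable_expn k)).
  have : n < q * (k * 2 ^ k).
    by apply: ltn_ceil; rewrite muln_gt0 k_gt0 expn_gt0.
  by move/ltnW/leq_trans; apply; rewrite leq_mul2l leqnSn orbT.
by rewrite leq_mul2l leq_pred orbT.
Qed.

Definition zero_or_row n (J : finType) (A : J -> 'I_n -> bool) (j : option J) :
    cube n :=
  if j is Some j then [ffun i => A j i] else [ffun=> false].

Lemma hamming_row n (J : finType) (A : J -> 'I_n -> bool) (u : cube n) j :
  hamming u [ffun i => A j i] + (row_sum A u j).*2 =
  hamming u [ffun=> false] + \sum_i A j i.
Proof.
rewrite -mul2n !hammingE big_distrr -!big_split /=; apply: eq_bigr => i _.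
by rewrite !ffunE; case: (u i) (A j i) => [] [].
Qed.

Lemma detecting_separating n (J : finType) (A : J -> 'I_n -> bool) :
  detecting A -> separating (@hamming n) (zero_or_row A).
Proof.
move=> detA u v uv; apply/ffunP; apply: (detA u v) => j.
have := hamming_row A u j; rewrite (uv (Some j)) (uv None) -hamming_row.
by move/addnI/double_inj.
Qed.

Lemma beta_folded_odd_le m n : odd n -> detectable m n -> beta_folded n <= m.+1.
Proof.
move=> odd_n /detectable_ord[J [A [/detecting_separating sepA <-]]].
by have := beta_folded_le (separating_fold_odd odd_n sepA); rewrite card_option.
Qed.

Lemma beta_folded_le_double m n :
  0 < n -> detectable m n -> beta_folded n <= 2 * m.+1.
Proof.
move=> n_gt0 /detectable_ord[J [A [/detecting_separating sepA <-]]].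
have := beta_folded_le (separating_fold_flip (i := Ordinal n_gt0) sepA).
by rewrite card_prod card_option card_bool mulnC.
Qed.

(** * The counting bound *)

Section SecondMoment.
Variables (n : nat) (y : cube n).
Implicit Type u : cube n.

Definition agreement_sign (i : 'I_n) u : int := ((-1) ^+ (u i != y i))%R.

Lemma sum_agreement_sign u :
  (\sum_i agreement_sign i u = n%:Z - 2 * (hamming u y)%:Z)%R.
Proof.
rewrite hammingE -[in (n%:Z)%R](card_ord n) -sum1_card.
rewrite !(big_morph Posz PoszD (erefl _)) mulr_sumr -sumrB.
by apply: eq_bigr => i _; rewrite /agreement_sign; case: (u i != y i).
Qed.

Lemma agreement_sign_flip i j u :
  agreement_sign j (flip i u) = ((-1) ^+ (j == i) * agreement_sign j u)%R.
Proof.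
rewrite /agreement_sign ffunE -signr_addb; congr (_ ^+ nat_of_bool _)%R.
by case: (u j) (y j) (j == i) => [] [] [].
Qed.

Lemma agreement_sign_orthogonal i j :
  (\sum_u agreement_sign i u * agreement_sign j u = (2 ^+ n) *+ (i == j))%R.
Proof.
have [<-|neq_ij] := eqVneq i j.
  under eq_bigr do rewrite -expr2 sqrr_sign.
  by rewrite sumr_const card_cube -natrX natz.
set S := (LHS); suff : (S = - S)%R by lia.
rewrite /S -sumrN [LHS](reindex_inj (inv_inj (flipK i))) /=.
apply: eq_bigr => u _; rewrite !agreement_sign_flip eqxx eq_sym (negbTE neq_ij).
by rewrite expr1 expr0 mul1r mulN1r mulNr.
Qed.

Definition imbalance u : nat := n - 2 * fold_dist u y.

Lemma imbalance_sqr u :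
  ((imbalance u ^ 2)%N%:Z = (n%:Z - 2 * (hamming u y)%:Z) ^+ 2)%R.
Proof.
rewrite -[LHS]natz natrX natz; apply/eqP; rewrite eqf_sqr /imbalance /fold_dist.
by have := hamming_le u y; lia.
Qed.

Lemma imbalance_inj u v :
  imbalance u = imbalance v -> fold_dist u y = fold_dist v y.
Proof.
rewrite /imbalance /fold_dist.
by have := hamming_le u y; have := hamming_le v y; lia.
Qed.

Lemma sum_imbalance_sqr : \sum_u imbalance u ^ 2 = n * 2 ^ n.
Proof.
apply/eqP; rewrite -eqz_nat PoszM -(natz (2 ^ n)) natrX; apply/eqP.
rewrite (big_morph Posz PoszD (erefl _)).
under eq_bigr do rewrite imbalance_sqr -sum_agreement_sign expr2 big_distrlr /=.
rewrite exchange_big /= (eq_bigr (fun=> 2 ^+ n)%R) => [|i _].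
  by rewrite sumr_const card_ord -[LHS]mulr_natl natz.
rewrite exchange_big (bigD1 i) //= agreement_sign_orthogonal eqxx.
rewrite big1 ?addr0 // => j.
by rewrite agreement_sign_orthogonal eq_sym => /negbTE->.
Qed.

Lemma sum_imbalance_le s :
  0 < s -> n <= s ^ 2 -> \sum_u imbalance u <= s * 2 ^ n.
Proof.
move=> s_gt0 le_ns; rewrite -(leq_pmul2l (m := 2 * s)) ?muln_gt0 ?s_gt0 //.
rewrite big_distrr /=.
apply: (@leq_trans (\sum_u (s ^ 2 + imbalance u ^ 2))).
  apply: leq_sum => u _; rewrite -mulnA.
  exact: (nat_Cauchy s (imbalance u)).1.
rewrite big_split /= sum_imbalance_sqr sum_nat_const card_cube mulnC -mulnDl.
by rewrite mulnA leq_mul2r -mulnA mulnn mul2n -addnn leq_add2l le_ns orbT.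
Qed.

End SecondMoment.

Section HalfPowers.
Variable F : numFieldType.
Local Open Scope ring_scope.

Lemma sum_half_pow_div_le s N : (0 < s)%N ->
  \sum_(a < N) (2^-1 : F) ^+ (a %/ s) <= 2 * s%:R.
Proof.
move=> s_gt0.
have blocks M :
    \sum_(a < s * M) (2^-1 : F) ^+ (a %/ s) = 2 * s%:R * (1 - 2^-1 ^+ M).
  elim: M => [|M IHM]; first by rewrite muln0 big_ord0 expr0 subrr mulr0.
  rewrite mulnS addnC big_split_ord /= IHM.
  rewrite [X in _ + X](eq_bigr (fun=> 2^-1 ^+ M)) => [|i _].
    by rewrite sumr_const card_ord -mulr_natl exprS; field.
  by rewrite mulnC divnMDl // divn_small ?addn0.
have le_N : (N <= s * N)%N by rewrite leq_pmull.
apply: (@le_trans _ _ (\sum_(a < s * N) (2^-1 : F) ^+ (a %/ s))).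
  by rewrite -(subnKC le_N) big_split_ord /= lerDl sumr_ge0.
by rewrite blocks ler_piMr ?mulr_ge0 ?ler0n // lerBlDr lerDl exprn_ge0.
Qed.

Lemma half_pow_tangent (k m : nat) :
  1 + k%:R - m%:R <= 2 ^+ k * 2^-1 ^+ m :> F.
Proof.
have [le_mk|lt_km] := leqP m k.
  rewrite -(subnK le_mk) exprD -mulrA -exprMn divff // expr1n mulr1.
  by rewrite natrD addrA addrK -natrX nat1r ler_nat; apply: ltn_expl.
apply: (@le_trans _ _ 0); last by rewrite mulr_ge0 ?exprn_ge0.
by rewrite subr_le0 addrC natr1 ler_nat.
Qed.

Lemma half_pow_jensen (I : finType) (X : I -> nat) (k : nat) :
  (\sum_i X i <= k * #|I|)%N -> #|I|%:R <= 2 ^+ k * \sum_i 2^-1 ^+ X i :> F.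
Proof.
move=> le_mean; rewrite mulr_sumr.
apply: le_trans (ler_sum _ (fun i _ => half_pow_tangent k (X i))).
rewrite sumrB sumr_const -natr_sum mulrnDl -addrA lerDl subr_ge0.
by rewrite -mulrnA ler_nat.
Qed.

End HalfPowers.

Lemma sum_prod_fibre_le (F : numDomainType) (I J B : finType)
    (phi : I -> {ffun J -> B}) (g : B -> F) (c : nat) :
    (forall b, 0 <= g b)%R -> (forall f, #|[set i | phi i == f]| <= c) ->
  (\sum_i \prod_j g (phi i j) <= c%:R * (\sum_b g b) ^+ #|J|)%R.
Proof.
move=> g_ge0 fibre_le; rewrite (partition_big phi xpredT) //=.
rewrite -prodr_const (bigA_distr_bigA (fun=> g)) mulr_sumr.
apply: ler_sum => f _.
rewrite (eq_bigr (fun=> \prod_j g (f j))%R) => [|i /eqP->//].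
rewrite sumr_const -[leLHS]mulr_natl ler_wpM2r ?prodr_ge0 // ler_nat.
by apply: leq_trans (fibre_le f); rewrite cardsE.
Qed.

Section Profile.
Variables (n : nat) (J : finType) (y : J -> cube n).

Definition imbalance_profile (u : cube n) : {ffun J -> 'I_n.+1} :=
  [ffun j => inord (imbalance (y j) u)].

Lemma imbalance_profileE u j : imbalance_profile u j = imbalance (y j) u :> nat.
Proof. by rewrite ffunE inordK // ltnS leq_subr. Qed.

Lemma card_imbalance_profile_fibre f :
  fold_separating y -> #|[set u | imbalance_profile u == f]| <= 2.
Proof.
move=> sep_y; have [->|[u]] := set_0Vmem [set u | imbalance_profile u == f].
  by rewrite cards0.
rewrite inE => /eqP uf; apply: leq_trans (_ : #|[set u; antipode u]| <= 2).
  apply/subset_leq_card/fintype.subsetP => v.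
  rewrite !inE -folded_class_eq => /eqP vf.
  apply/eqP/sep_y => j; apply: imbalance_inj.
  by rewrite -!imbalance_profileE vf uf.
by rewrite cards2; case: (_ != _).
Qed.

Definition scaled_imbalance (s : nat) (u : cube n) : nat :=
  \sum_j imbalance (y j) u %/ s.

Lemma sum_scaled_imbalance_le s : 0 < s -> n <= s ^ 2 ->
  \sum_u scaled_imbalance s u <= #|J| * #|cube n|.
Proof.
move=> s_gt0 le_ns; rewrite exchange_big card_cube /= -sum_nat_const.
apply: leq_sum => j _; rewrite -(leq_pmul2l s_gt0) big_distrr /=.
apply: leq_trans (sum_imbalance_le (y j) s_gt0 le_ns).
by apply: leq_sum => u _; rewrite mulnC leq_divM.
Qed.

Lemma sum_half_pow_scaled_imbalance_le (F : numFieldType) s :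
    0 < s -> fold_separating y ->
  (\sum_u 2^-1 ^+ scaled_imbalance s u <= 2 * (2 * s%:R) ^+ #|J| :> F)%R.
Proof.
move=> s_gt0 sep_y; pose g (a : 'I_n.+1) : F := (2^-1 ^+ (a %/ s))%R.
have g_ge0 a : (0 <= g a)%R by rewrite exprn_ge0.
have -> : (\sum_u 2^-1 ^+ scaled_imbalance s u =
           \sum_u \prod_j g (imbalance_profile u j))%R.
  apply: eq_bigr => u _; rewrite expr_sum; apply: eq_bigr => j _.
  by rewrite /g imbalance_profileE.
have fibre_le f := card_imbalance_profile_fibre f sep_y.
apply: le_trans (sum_prod_fibre_le g_ge0 fibre_le) _.
rewrite ler_wpM2l // lerXn2r ?nnegrE ?mulr_ge0 ?sumr_ge0 //.
exact: sum_half_pow_div_le.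
Qed.

Lemma fold_separating_card s : 0 < s -> n <= s ^ 2 -> fold_separating y ->
  2 ^ n <= 2 * (4 * s) ^ #|J|.
Proof.
move=> s_gt0 le_ns sep_y; rewrite -(ler_nat rat) -card_cube.
apply: le_trans (half_pow_jensen _ (sum_scaled_imbalance_le s_gt0 le_ns)) _.
have le_pow := sum_half_pow_scaled_imbalance_le rat s_gt0 sep_y.
apply: le_trans (ler_wpM2l _ le_pow) _; first by rewrite exprn_ge0.
by rewrite mulrCA -exprMn natrM natrX natrM mulrA -natrM.
Qed.

End Profile.

Lemma beta_folded_card n s : 0 < s -> n <= s ^ 2 ->
  2 ^ n <= 2 * (4 * s) ^ beta_folded n.
Proof.
move=> s_gt0 le_ns; have [y sep_y] := beta_folded_separating n.
by have := fold_separating_card s_gt0 le_ns sep_y; rewrite card_ord.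
Qed.

(** * Asymptotics *)

Lemma beta_folded_ge_expn n t :
  n <= 2 ^ (2 * t) -> n <= (t + 2) * beta_folded n + 1.
Proof.
rewrite mulnC expnM => /(beta_folded_card (expn_gt0 2 t)).
by rewrite -[4]/(2 ^ 2) -expnD -expnM -expnS leq_exp2l // addn1 addnC.
Qed.

Local Open Scope classical_set_scope.
Local Open Scope ring_scope.

Section Limits.
Variable R : realFieldType.

Lemma cvgryV0 (T : Type) (F : set_system T) {FF : Filter F} (f : T -> R) :
  f x @[x --> F] --> +oo -> (f x)^-1 @[x --> F] --> 0.
Proof. by move=> f_oo; apply/gtr0_cvgV0 => //; apply: cvgry_gt f_oo 0. Qed.

Lemma cvg_if_squeeze (T : Type) (F : set_system T) {FF : Filter F}
    (P : pred T) (a b f : T -> R) (l : R) :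
    (\forall x \near F, P x -> a x <= f x <= b x) ->
    a x @[x --> F] --> l -> b x @[x --> F] --> l ->
  (if P x then f x else l) @[x --> F] --> l.
Proof.
move=> near_ab /cvgrPdist_le cvg_a /cvgrPdist_le cvg_b.
apply/cvgrPdist_le => e e_gt0; near=> x.
case: ifP => [Px|_]; last by rewrite subrr normr0 ltW.
have /(_ Px)/andP[le_af le_fb] : P x -> a x <= f x <= b x by near: x.
have : `|l - a x| <= e by near: x; apply: cvg_a.
have : `|l - b x| <= e by near: x; apply: cvg_b.
by rewrite !ler_norml => /andP[? ?] /andP[? ?]; apply/andP; split; lra.
Unshelve. all: by end_near. Qed.

End Limits.

Section Log2.
Variable R : realType.
Implicit Types x y : R.

Lemma ln2_gt0 : 0 < ln 2 :> R.
Proof. by rewrite ln_gt0 // ltr1n. Qed.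

Lemma ler_log2 : {in Num.pos &, {mono @log2 R : x y / x <= y}}.
Proof.
by move=> x y x_gt0 y_gt0; rewrite /log2 ler_pM2r ?invr_gt0 ?ln2_gt0 // ler_ln.
Qed.

Lemma log2_div : {in Num.pos &, {morph @log2 R : x y / x / y >-> x - y}}.
Proof. by move=> x y x_gt0 y_gt0; rewrite /log2 ln_div // mulrBl. Qed.

Lemma log2X k x : 0 < x -> log2 (x ^+ k) = log2 x *+ k.
Proof. by move=> x_gt0; rewrite /log2 lnXn // mulrnAl. Qed.

Lemma log2_exp2 k : log2 (2 ^+ k) = k%:R :> R.
Proof. by rewrite log2X // /log2 divff ?gt_eqF ?ln2_gt0. Qed.

Lemma cvgr_log2 : log2 x @[x --> +oo] --> (+oo : set_system R).
Proof.
apply/cvgryPge => A; near=> x.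
have le_x : expR (A * ln 2) <= x.
  by near: x; apply: nbhs_pinfty_ge; apply: num_real.
have x_gt0 := lt_le_trans (expR_gt0 _) le_x.
by rewrite ler_pdivlMr ?ln2_gt0 // -ler_expR lnK.
Unshelve. all: by end_near. Qed.

(* With d = e / 2, sublinearity of ln at d x gives ln x < d x - ln d. *)
Lemma cvgr_ln_div : ln x / x @[x --> +oo] --> (0 : R).
Proof.
apply/cvgr0Pnorm_le => e e_gt0; pose d := e / 2.
have d_gt0 : 0 < d by rewrite divr_gt0.
near=> x; have x_ge1 : 1 <= x.
  by near: x; apply: nbhs_pinfty_ge; apply: num_real.
have x_gt0 : 0 < x := lt_le_trans ltr01 x_ge1.
have lnd_le : - ln d / d <= x.
  by near: x; apply: nbhs_pinfty_ge; apply: num_real.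
rewrite ger0_norm ?ler_pdivrMr //; last by rewrite divr_ge0 ?ln_ge0 // ltW.
have := ln_sublinear (mulr_gt0 d_gt0 x_gt0); rewrite lnM //.
have -> : e = d + d by rewrite -splitr.
by move: lnd_le; rewrite ler_pdivrMr //; lra.
Unshelve. all: by end_near. Qed.

Lemma cvgr_log2_div : log2 x / x @[x --> +oo] --> (0 : R).
Proof.
have -> : (fun x => log2 x / x) = (fun x => (ln x / x) * (ln 2)^-1).
  by apply/funext => x; rewrite mulrAC.
by rewrite -[0](mul0r (ln 2)^-1); apply: cvgM cvgr_ln_div (cvg_cst _).
Qed.

End Log2.

Section Estimates.
Variable R : realType.

Definition n_over_log2 (n : nat) : R := n%:R / log2 n%:R.

Lemma beta_folded_ge_log2 n : (0 < n)%N ->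
  2 * (n%:R - 1) <= (log2 n%:R + 6) * (beta_folded n)%:R :> R.
Proof.
move=> n_gt0; set L := log2 _; pose t := Num.truncn (L / 2).
have n_ge1 : 1 <= n%:R :> R by rewrite ler1n.
have L_ge0 : 0 <= L by rewrite divr_ge0 ?ln_ge0 ?ler1n.
have /andP[t_le t_gt] : t%:R <= L / 2 < t.+1%:R.
  by apply: truncn_itv; apply: divr_ge0.
have le_n : (n <= 2 ^ (2 * t.+1))%N.
  rewrite -(ler_nat R) natrX -ler_log2 ?posrE ?exprn_gt0 ?ltr0n //.
  by rewrite log2_exp2 natrM -/L; lra.
have := beta_folded_ge_expn le_n; rewrite -(ler_nat R) natrD natrM natrD -natr1.
have : 0 <= (beta_folded n)%:R :> R by [].
by move: (beta_folded n)%:R => b b_ge0; nra.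
Qed.

Lemma detectable_exists_natr n k : (0 < k)%N ->
  exists2 m, detectable m n & m.+1%:R <= 2 * n%:R / k%:R + 3 * 2 ^+ k :> R.
Proof.
move=> k_gt0; have [m det_m le_m] := detectable_exists n k_gt0; exists m => //.
have := leq_divM n (k * 2 ^ k); move: (n %/ _)%N le_m => q le_m le_q.
have le_m' : m%:R <= 2 * (2 ^+ k + q%:R * 2 ^+ k) :> R.
  by rewrite -natrX -natrM -natrD -natrM ler_nat -mulSn mulnCA -expnS.
have le_q' : q%:R * 2 ^+ k <= n%:R / k%:R :> R.
  by rewrite ler_pdivlMr ?ltr0n // -natrX -!natrM ler_nat -mulnA (mulnC _ k).
have pow_ge1 : 1 <= 2 ^+ k :> R by rewrite exprn_ege1 // ler1n.
by rewrite -natr1 -mulrA; lra.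
Qed.

(* Taking k just below L - 2 log2 L makes 2 ^ k at most n / L ^ 2, hence *)
(* negligible against n / L, while k is still asymptotic to L.           *)
Lemma detectable_exists_log2 n (L := log2 n%:R : R) :
    0 < L -> 1 < L - 2 * log2 L ->
  exists2 m, detectable m n &
    m.+1%:R <= 2 * n%:R / (L - 2 * log2 L - 1) + 3 * (n%:R / L ^+ 2) :> R.
Proof.
set K := L - _ => L_gt0 K_gt1; pose k := Num.truncn K.
have K_gt0 : 0 < K by apply: lt_trans K_gt1.
have /andP[k_le k_gt] : k%:R <= K < k.+1%:R by apply: truncn_itv; apply: ltW.
have k_gt0 : (0 < k)%N by rewrite truncn_gt0 ltW.
have n_gt0 : 0 < n%:R :> R.
  rewrite ltr0n lt0n; apply: contraTneq L_gt0 => n0.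
  by rewrite /L n0 /log2 ln0 // mul0r ltxx.
have pow_le : 2 ^+ k <= n%:R / L ^+ 2.
  rewrite -ler_log2 ?posrE ?divr_gt0 ?exprn_gt0 //.
  rewrite log2_exp2 log2_div ?posrE ?exprn_gt0 //.
  by rewrite log2X // -[_ *+ 2]mulr_natl.
have [m det_m le_m] := detectable_exists_natr n k_gt0; exists m => //.
apply: le_trans le_m _; apply: lerD; last by rewrite ler_wpM2l.
rewrite ler_wpM2l ?mulr_ge0 // lef_pV2 ?posrE ?subr_gt0 ?ltr0n //.
by rewrite lerBlDr natr1 ltW.
Qed.

Definition lower_factor (n : nat) : R := (2 - 2 / n%:R) / (1 + 6 / log2 n%:R).

Definition upper_slack (x : R) : R := 1 - 2 * (log2 x / x) - x^-1.

Definition upper_factor (n : nat) : R :=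
  2 / upper_slack (log2 n%:R) + 3 / log2 n%:R.

Lemma cvg_log2_natr : log2 n%:R @[n --> \oo] --> (+oo : set_system R).
Proof. exact: cvg_comp cvgr_idn (@cvgr_log2 R). Qed.

Lemma cvg_lower_factor : lower_factor n @[n --> \oo] --> (2 : R).
Proof.
have -> : 2 = (2 - 2 * 0) / (1 + 6 * 0) :> R.
  by rewrite !mulr0 subr0 addr0 divr1.
have cvg_num : 2 - 2 / n%:R @[n --> \oo] --> (2 - 2 * 0 : R).
  exact: cvgB (cvg_cst _) (cvgM (cvg_cst _) (cvgryV0 cvgr_idn)).
have cvg_den : 1 + 6 / log2 n%:R @[n --> \oo] --> (1 + 6 * 0 : R).
  exact: cvgD (cvg_cst _) (cvgM (cvg_cst _) (cvgryV0 cvg_log2_natr)).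
apply: cvgM cvg_num (cvgV _ cvg_den).
by rewrite mulr0 addr0 oner_neq0.
Qed.

Lemma cvg_upper_slack : upper_slack (log2 n%:R) @[n --> \oo] --> (1 : R).
Proof.
have cvg_loglog : log2 (log2 n%:R) / log2 n%:R @[n --> \oo] --> (0 : R).
  exact: cvg_comp cvg_log2_natr (@cvgr_log2_div R).
have cvg_main :
    1 - 2 * (log2 (log2 n%:R) / log2 n%:R) @[n --> \oo] --> (1 - 2 * 0 : R).
  exact: cvgB (cvg_cst _) (cvgM (cvg_cst _) cvg_loglog).
suff : upper_slack (log2 n%:R) @[n --> \oo] --> (1 - 2 * 0 - 0 : R).
  by rewrite mulr0 !subr0.
exact: cvgB cvg_main (cvgryV0 cvg_log2_natr).
Qed.

Lemma cvg_upper_factor : upper_factor n @[n --> \oo] --> (2 : R).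
Proof.
have -> : 2 = 2 / 1 + 3 * 0 :> R by rewrite mulr0 addr0 divr1.
apply: cvgD; last exact: cvgM (cvg_cst _) (cvgryV0 cvg_log2_natr).
exact: cvgM (cvg_cst _) (cvgV (oner_neq0 R) cvg_upper_slack).
Qed.

Lemma near_n_over_log2_gt0 : \forall n \near \oo, 0 < n_over_log2 n.
Proof.
apply: filterS2 (cvgry_gt cvgr_idn 0) (cvgry_gt cvg_log2_natr 0) => n.
exact: divr_gt0.
Qed.

Lemma near_beta_folded_ge :
  \forall n \near \oo, lower_factor n * n_over_log2 n <= (beta_folded n)%:R.
Proof.
near=> n.
have n_gt0 : (0 < n)%N by near: n; exact: nbhs_infty_gt.
have nR_gt0 : 0 < n%:R :> R by rewrite ltr0n.
have L_gt0 : 0 < log2 n%:R :> R by near: n; apply: cvgry_gt cvg_log2_natr 0.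
have L6_gt0 : 0 < log2 n%:R + 6 :> R by rewrite addr_gt0.
have -> : lower_factor n * n_over_log2 n = 2 * (n%:R - 1) / (log2 n%:R + 6).
  by rewrite /lower_factor /n_over_log2; field; rewrite !gt_eqF.
by rewrite ler_pdivrMr // [leRHS]mulrC beta_folded_ge_log2.
Unshelve. all: by end_near. Qed.

Lemma near_detectable : \forall n \near \oo, exists2 m,
  detectable m n & m.+1%:R <= upper_factor n * n_over_log2 n.
Proof.
near=> n.
have L_gt0 : 0 < log2 n%:R :> R by near: n; apply: cvgry_gt cvg_log2_natr 0.
have slack_gt0 : 0 < upper_slack (log2 n%:R).
  by near: n; apply: cvgr_gt cvg_upper_slack _ ltr01.
have slackE : log2 n%:R - 2 * log2 (log2 n%:R) - 1 =
    upper_slack (log2 n%:R) * log2 n%:R.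
  by rewrite /upper_slack; field; rewrite gt_eqF.
have [|m det_m le_m] := detectable_exists_log2 L_gt0.
  by rewrite -subr_gt0 slackE mulr_gt0.
exists m => //; apply: (le_trans le_m); rewrite slackE.
set bound := (leLHS); suff -> : upper_factor n * n_over_log2 n = bound by [].
by rewrite /upper_factor /n_over_log2 /bound; field; rewrite !gt_eqF.
Unshelve. all: by end_near. Qed.

Lemma near_beta_folded_odd_le : \forall n \near \oo, odd n ->
  (beta_folded n)%:R <= upper_factor n * n_over_log2 n.
Proof.
apply: filterS near_detectable => n [m det_m le_m] odd_n.
by apply: le_trans le_m; rewrite ler_nat beta_folded_odd_le.
Qed.

Lemma near_beta_folded_le : \forall n \near \oo,
  (beta_folded n)%:R <= 2 * upper_factor n * n_over_log2 n.
Proof.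
apply: filterS2 (nbhs_infty_gt 0) near_detectable => n n_gt0 [m det_m le_m].
apply: (@le_trans _ _ (2 * m.+1)%:R).
  by rewrite ler_nat beta_folded_le_double.
by rewrite natrM -mulrA ler_wpM2l.
Qed.

End Estimates.

Theorem theorem10 (R : realType) :
  (exists o : nat -> R,
     o n @[n --> \oo] --> (0 : R) /\
     \forall n \near \oo, odd n ->
       (beta_folded n)%:R = (2 + o n) * (n%:R / log2 (n%:R : R)))
  /\
  (exists o1 o2 : nat -> R,
     [/\ o1 n @[n --> \oo] --> (0 : R),
         o2 n @[n --> \oo] --> (0 : R) &
         \forall n \near \oo, ~~ odd n ->
           (2 + o1 n) * (n%:R / log2 (n%:R : R)) <= (beta_folded n)%:R /\
           (beta_folded n)%:R <= (4 + o2 n) * (n%:R / log2 (n%:R : R))]).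
Proof.
split.
  pose ratio n := (beta_folded n)%:R / n_over_log2 R n.
  exists (fun n => (if odd n then ratio n else 2) - 2); split.
    rewrite -(subrr (2 : R)); apply: cvgB (cvg_cst _).
    apply: cvg_if_squeeze (@cvg_lower_factor R) (@cvg_upper_factor R).
    near=> n => odd_n.
    have scale_gt0 : 0 < n_over_log2 R n.
      by near: n; apply: near_n_over_log2_gt0.
    rewrite ler_pdivlMr // ler_pdivrMr //; apply/andP; split.
      by near: n; apply: near_beta_folded_ge.
    by move: odd_n; near: n; apply: near_beta_folded_odd_le.
  apply: filterS (near_n_over_log2_gt0 R) => n scale_gt0 ->.
  by rewrite subrKC divfK // gt_eqF.
exists (fun n => lower_factor R n - 2), (fun n => 2 * upper_factor R n - 4).
split.
- by rewrite -(subrr (2 : R)); apply: cvgB (@cvg_lower_factor R) (cvg_cst _).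
- have -> : 0 = 2 * 2 - 4 :> R by rewrite -natrM subrr.
  exact: cvgB (cvgM (cvg_cst _) (@cvg_upper_factor R)) (cvg_cst _).
apply: filterS2 (near_beta_folded_ge R) (near_beta_folded_le R) => n ge_n le_n _.
by rewrite !subrKC.
Unshelve. all: by end_near. Qed.
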